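(* Let $A\in\mathbb{C}^{I\times J}$ be an $\mathcal{H}$-matrix with cluster trees $\mathcal{T}_I$, $\mathcal{T}_J$, block cluster tree $\mathcal{T}_{I\times J}$, admissible partition $P^+_{I\times J}=\mathcal{L}^+(\mathcal{T}_{I\times J})$, sparsity constant $c_{\mathrm{sp}}$, and maximum block rank $k_{\max}$. Then there exist positive constants $C_{\mathrm{qlin}},C_{\mathrm{lin}}\in\mathbb{R}$ such that the uniform compression algorithm (described in the context) applied to $A$ requires no more than $$C_{\mathrm{qlin}}(c_{\mathrm{sp}}k_{\max})^2\bigl(L(\mathcal{T}_I)|I|+L(\mathcal{T}_J)|J|\bigr)+C_{\mathrm{lin}}(c_{\mathrm{sp}}k_{\max})^3\bigl(|I|+|J|\bigr)$$ operations. In the boundary element setting in which $L(\mathcal{T}_I)\sim\log|I|$ and $L(\mathcal{T}_J)\sim\log|J|$, and $c_{\mathrm{sp}}$ and $k_{\max}$ are bounded (independently of $|I|$ and $|J|$), this yields a complexity of $\mathcal{O}(|I|\log|I|+|J|\log|J|)$ for increasing dimension of the matrix.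
   Context: **Cluster tree.** A cluster tree $\mathcal{T}_I$ for a finite index set $I$ is a finite tree whose nodes (clusters) are subsets of $I$, with root $I$, such that for each non-leaf node $\tau$ its set of children $s(\tau)$ is a partition of $\tau$ into pairwise disjoint subsets. The level of a cluster is its distance to the root; the depth is $L(\mathcal{T}_I)=\max_{\tau}\mathrm{level}(\tau)+1$. The minimal size of a cluster in $\mathcal{T}_I$ and $\mathcal{T}_J$ is denoted $n_{\min}$. **Block cluster tree.** A block cluster tree $\mathcal{T}_{I\times J}$ is a cluster tree for $I\times J$ in which every node (block) has the form $b=\tau\times\sigma$ with $\tau\in\mathcal{T}_I$, $\sigma\in\mathcal{T}_J$, and for each non-leaf $b=\tau\times\sigma$ one has $s(b)=s(\tau)\times s(\sigma)$, $\{\tau\}\times s(\sigma)$ or $s(\tau)\times\{\sigma\}$. Its leaves are divided into an admissible part $P^+_{I\times J}=\mathcal{L}^+(\mathcal{T}_{I\times J})$ and an inadmissible (dense) part. **Sparsity constant.** $\mathcal{L}'_I=\{\tau\in\mathcal{T}_I:\exists\sigma,\ \tau\times\sigma\in P^+_{I\times J}\}$, $\mathcal{L}'_J=\{\sigma\in\mathcal{T}_J:\exists\tau,\ \tau\times\sigma\in P^+_{I\times J}\}$, $\mathrm{row}(\tau)=\{\sigma:\tau\times\sigma\in P^+_{I\times J}\}$, $\mathrm{col}(\sigma)=\{\tau:\tau\times\sigma\in P^+_{I\times J}\}$, and $c_{\mathrm{sp}}=\max\{\max_{\tau\in\mathcal{L}'_I}|\mathrm{row}(\tau)|,\max_{\sigma\in\mathcal{L}'_J}|\mathrm{col}(\sigma)|\}$.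 **$\mathcal{H}$-matrix.** For each $b=\tau\times\sigma\in P^+_{I\times J}$ a factorization $A|_b=X_bY_b^*$ with $X_b\in\mathbb{C}^{\tau\times k_b}$, $Y_b\in\mathbb{C}^{\sigma\times k_b}$ is given; $k_{\max}=\max_bk_b$. **Uniform compression algorithm.** Input: the factors $\{(X_b,Y_b)\}_{b\in P^+_{I\times J}}$ and tolerances $\{\epsilon_\tau\}_{\tau\in\mathcal{L}'_I}$, $\{\epsilon_\sigma\}_{\sigma\in\mathcal{L}'_J}$. For each $\tau\in\mathcal{L}'_I$: 1. For each $\sigma\in\mathrm{row}(\tau)$, with $b=\tau\times\sigma$, compute a QR-decomposition $Y_b=Q_{Y,b}R_{Y,b}$ (of the $|\sigma|\times k_b$ matrix $Y_b$) and form the product $X_bR_{Y,b}^*$ (a triangular matrix-matrix product), placing it as a block of columns in $X_\tau\in\mathbb{C}^{\tau\times k_\tau^{\mathrm{tot}}}$, where $k_\tau^{\mathrm{tot}}=\sum_{\sigma\in\mathrm{row}(\tau)}k_{\tau\times\sigma}$. 2. Compute the SVD $X_\tau=U\Sigma V^*$, choose the rank $\ell_\tau\le k_\tau^{\mathrm{tot}}$ according to $\epsilon_\tau$, and let $U_\tau$ be the first $\ell_\tau$ columns of $U$. 3. For each $\sigma\in\mathrm{row}(\tau)$, with $b=\tau\times\sigma$, compute $S_{X,b}=\hat\Sigma\,(\hat V^* )|_b\,(R_{Y,b}^* )^{-1}\in\mathbb{C}^{\ell_\tau\times k_b}$, where $\hat\Sigma$ is the leading $\ell_\tau\times\ell_\tau$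 block of $\Sigma$, $\hat V$ consists of the first $\ell_\tau$ columns of $V$, and $(\hat V^* )|_b$ is the $\ell_\tau\times k_b$ block of columns of $\hat V^*$ corresponding to the block of columns of $X_\tau$ belonging to $b$ (a diagonal scaling followed by a triangular solve). Then the same is repeated for each $\sigma\in\mathcal{L}'_J$ with the roles of $X_b$ and $Y_b$ (and of rows and columns) exchanged, giving $V_\sigma$ and $S_{Y,b}$. The output is the uniform $\mathcal{H}$-matrix with admissible blocks $U_\tau S_{X,b}S_{Y,b}^*V_\sigma^*$. **Operation counts.** The operation count is the sum of the costs of the following kernels, with fixed constants $C_{\mathrm{qr}},C^{(1)}_{\mathrm{svd}},C^{(2)}_{\mathrm{svd}}>0$: a QR-decomposition of an $m\times n$ matrix costs at most $C_{\mathrm{qr}}mn^2$; its SVD costs at most $C^{(1)}_{\mathrm{svd}}mn^2+C^{(2)}_{\mathrm{svd}}n^3$; a triangular matrix-matrix product or triangular solve with matrices of sizes $m\times n$ and $n\times n$ costs $mn^2$; diagonal scaling of an $m\times n$ matrix costs $mn$. *)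

(* Defs.v *)
From HB Require Import structures.
From mathcomp Require Import all_boot all_order all_algebra.
From mathcomp Require Import complex.
From mathcomp Require Import reals.

Set Implicit Arguments.
Unset Strict Implicit.
Unset Printing Implicit Defensive.

Import Order.TTheory GRing.Theory Num.Theory.

Local Open Scope ring_scope.
Local Open Scope sesquilinear_scope.
Local Open Scope complex_scope.

(* [partition] forbids empty parts, so [clusters_neq0] only adds that the index
   set I itself is nonempty. Being a tree is the uniqueness of the path from the
   root to each node; in particular {t} is never the set of children of t. *)
Record cluster_tree (I : finType) := ClusterTree {
  clusters :> {set {set I}};
  children : {set I} -> {set {set I}};
  root_cluster : [set: I] \in clusters;
  clusters_neq0 : set0 \notin clusters;
  children_sub : forall t, t \in clusters -> children t \subset clusters;
  children_partition : forall t, t \in clusters ->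
    children t != set0 -> partition (children t) t;
  cluster_path : forall t, t \in clusters ->
    exists! p : seq {set I},
      path (fun u v => v \in children u) [set: I] p /\ last [set: I] p = t
}.

Section ClusterTree.
Context (I : finType) (T : cluster_tree I).

Definition generation (n : nat) : {set {set I}} :=
  iter n (fun G : {set {set I}} => \bigcup_(t in G) children T t) [set [set: I]].

Definition level (t : {set I}) : nat :=
  find (fun n => t \in generation n) (iota 0 #|clusters T|).

Definition depth : nat := (\max_(t in clusters T) level t).+1.

Definition leaves : {set {set I}} := [set t in clusters T | children T t == set0].

End ClusterTree.

Record block_cluster_tree (I J : finType)
    (TI : cluster_tree I) (TJ : cluster_tree J) := BlockClusterTree {
  block_tree :> cluster_tree (I * J)%type;
  block_setX : forall b, b \in clusters block_tree ->
    exists t s, [/\ t \in clusters TI, s \in clusters TJ & b = setX t s];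
  block_children : forall t s, t \in clusters TI -> s \in clusters TJ ->
    setX t s \in clusters block_tree -> children block_tree (setX t s) != set0 ->
    [\/ children block_tree (setX t s) =
          [set setX t' s' | t' in children TI t, s' in children TJ s],
        children block_tree (setX t s) = [set setX t s' | s' in children TJ s] |
        children block_tree (setX t s) = [set setX t' s | t' in children TI t]]
}.

(* The rows (columns) of a matrix in C^{t x k} are numbered along [enum t]. *)
Record hmatrix (R : realType) (I J : finType)
    (TI : cluster_tree I) (TJ : cluster_tree J) (T : block_cluster_tree TI TJ)
    (A : I -> J -> R[i]) := HMatrix {
  adm : {set {set I * J}};
  adm_leaves : adm \subset leaves T;
  block_rank : {set I} -> {set J} -> nat;
  factX : forall (t : {set I}) (s : {set J}), 'M[R[i]]_(#|t|, block_rank t s);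
  factY : forall (t : {set I}) (s : {set J}), 'M[R[i]]_(#|s|, block_rank t s);
  factE : forall t s, t \in clusters TI -> s \in clusters TJ ->
    setX t s \in adm ->
    \matrix_(i < #|t|, j < #|s|) A (enum_val i) (enum_val j) =
      factX t s *m (factY t s)^t*
}.

Section Sparsity.
Context (R : realType) (I J : finType) (TI : cluster_tree I) (TJ : cluster_tree J).
Context (T : block_cluster_tree TI TJ) (A : I -> J -> R[i]) (H : hmatrix T A).

Definition rowset (t : {set I}) : {set {set J}} :=
  [set s in clusters TJ | setX t s \in adm H].
Definition colset (s : {set J}) : {set {set I}} :=
  [set t in clusters TI | setX t s \in adm H].

Definition adm_rows : {set {set I}} := [set t in clusters TI | rowset t != set0].
Definition adm_cols : {set {set J}} := [set s in clusters TJ | colset s != set0].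

Definition c_sp : nat :=
  maxn (\max_(t in adm_rows) #|rowset t|) (\max_(s in adm_cols) #|colset s|).

Definition k_max : nat :=
  \max_(t in adm_rows) \max_(s in rowset t) block_rank H t s.

End Sparsity.

Record counted (B : Type) := Counted { value : B; ops : nat }.

Definition cret (B : Type) (x : B) : counted B := Counted x 0.

Definition cbind (B C : Type) (m : counted B) (f : B -> counted C) : counted C :=
  let m' := f (value m) in Counted (value m') (ops m + ops m').

Notation "'do' x <- m ; c" := (cbind m (fun x => c))
  (at level 200, x pattern, m at level 100, c at level 200).

(* Only the iterations with index in D are performed and counted; the values at
   the other indices are placeholders. *)
Definition for_each (S : finType) (D : {set S}) (B : S -> Type)
    (f : forall s, counted (B s)) : counted (forall s, B s) :=
  Counted (fun s => value (f s)) (\sum_(s in D) ops (f s))%N.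

(* Reduced decompositions of an m x n matrix. If m < n, only the first m columns
   of Q and U can be orthonormal; if n <= m, the conditions say that all columns
   are. *)
Definition first_cols_orthonormal (R : realType) m n (Q : 'M[R[i]]_(m, n)) : Prop :=
  forall i j : 'I_n, (i < m)%N -> (j < m)%N -> (Q^t* *m Q) i j = (i == j)%:R.

Definition is_qr (R : realType) m n (A Q : 'M[R[i]]_(m, n)) (T : 'M[R[i]]_n) : Prop :=
  [/\ A = Q *m T, first_cols_orthonormal Q & is_trig_mx T^T].

Definition is_svd (R : realType) m n
    (A U : 'M[R[i]]_(m, n)) (d : 'rV[R]_n) (V : 'M[R[i]]_n) : Prop :=
  [/\ A = U *m diag_mx (map_mx (real_complex R) d) *m V^t*,
      first_cols_orthonormal U, V \is unitarymx,
      (forall i, 0 <= d 0 i) &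
      (forall i j : 'I_n, (i <= j)%N -> d 0 j <= d 0 i)].

Record kernels (R : realType) (Cqr Csvd1 Csvd2 : R) := Kernels {
  qr : forall m n, 'M[R[i]]_(m, n) -> counted ('M[R[i]]_(m, n) * 'M[R[i]]_n);
  qrP : forall m n (A : 'M[R[i]]_(m, n)),
    is_qr A (value (qr A)).1 (value (qr A)).2;
  qr_ops : forall m n (A : 'M[R[i]]_(m, n)),
    (ops (qr A))%:R <= Cqr * m%:R * n%:R ^+ 2;
  svd : forall m n, 'M[R[i]]_(m, n) ->
    counted ('M[R[i]]_(m, n) * 'rV[R]_n * 'M[R[i]]_n);
  svdP : forall m n (A : 'M[R[i]]_(m, n)),
    is_svd A (value (svd A)).1.1 (value (svd A)).1.2 (value (svd A)).2;
  svd_ops : forall m n (A : 'M[R[i]]_(m, n)),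
    (ops (svd A))%:R <= Csvd1 * m%:R * n%:R ^+ 2 + Csvd2 * n%:R ^+ 3
}.

Definition tri_mul (R : realType) m n (A : 'M[R[i]]_(m, n)) (T : 'M[R[i]]_n) :
    counted 'M[R[i]]_(m, n) :=
  Counted (A *m T) (m * n ^ 2).

(* [invmx] is total: nothing is assumed here about T being invertible. *)
Definition tri_solve (R : realType) m n (A : 'M[R[i]]_(m, n)) (T : 'M[R[i]]_n) :
    counted 'M[R[i]]_(m, n) :=
  Counted (A *m invmx T) (m * n ^ 2).

Definition diag_scale (R : realType) m n (d : 'rV[R]_m) (A : 'M[R[i]]_(m, n)) :
    counted 'M[R[i]]_(m, n) :=
  Counted (diag_mx (map_mx (real_complex R) d) *m A) (m * n).

(* The rank may be any function of the tolerance and the singular values. *)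
Definition rank_rule (R : realType) := R -> forall n, 'rV[R]_n -> 'I_n.+1.

Definition first_cols (B : Type) m n (l : 'I_n.+1) (M : 'M[B]_(m, n)) : 'M[B]_(m, l) :=
  colsub (widen_ord (ltn_ord l : (l <= n)%N)) M.

(* The block of columns of W that belongs to s, for W made of consecutive blocks
   of k s columns, s running through [enum D]. The dimensions of the two branches
   of [conform_mx] agree since the index j that is picked has [enum_val j = s]. *)
Definition col_block (R : realType) (S : finType) (D : {set S}) (k : S -> nat) l
    (W : 'M[R[i]]_(l, \sum_(j < #|D|) k (enum_val j))) (s : S) : 'M[R[i]]_(l, k s) :=
  if [pick j : 'I_#|D| | enum_val j == s] is Some j
  then conform_mx 0 (submxrow W j) else 0.

Record cluster_basis (R : realType) (m : nat) (S : Type) (k : S -> nat) :=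
  ClusterBasis {
    cb_rank : nat;
    cb_basis : 'M[R[i]]_(m, cb_rank);
    cb_coupling : forall s, 'M[R[i]]_(cb_rank, k s)
  }.

(* One pass of the loop, for a cluster with m elements and the blocks
   X s *m (Y s)^t*, s \in D *)
Definition compress_cluster (R : realType) (Cqr Csvd1 Csvd2 : R)
    (K : kernels Cqr Csvd1 Csvd2) (rule : rank_rule R) (eps : R)
    (S : finType) (D : {set S}) (m : nat) (h k : S -> nat)
    (X : forall s, 'M[R[i]]_(m, k s)) (Y : forall s, 'M[R[i]]_(h s, k s)) :
    counted (cluster_basis R m k) :=
  do QR <- for_each D (fun s => qr K (Y s));
  do Z <- for_each D (fun s => tri_mul (X s) ((QR s).2 ^t*));
  do (U, d, V) <- svd K (\mxrow_(j < #|D|) Z (enum_val j));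
  let l := rule eps _ d in
  do W <- for_each D (fun s =>
            diag_scale (first_cols l d) (col_block ((first_cols l V)^t*) s));
  do C <- for_each D (fun s => tri_solve (W s) ((QR s).2 ^t*));
  cret (ClusterBasis (first_cols l U) C).

Record uniform_hmatrix (R : realType) (I J : finType)
    (k : {set I} -> {set J} -> nat) := UniformHMatrix {
  row_basis : forall t : {set I}, cluster_basis R #|t| (k t);
  col_basis : forall s : {set J}, cluster_basis R #|s| (k ^~ s)
}.

Definition uniform_block (R : realType) (I J : finType)
    (k : {set I} -> {set J} -> nat) (B : uniform_hmatrix R k)
    (t : {set I}) (s : {set J}) :
    'M[R[i]]_(#|t|, #|s|) :=
  cb_basis (row_basis B t) *m cb_coupling (row_basis B t) s *m
  (cb_coupling (col_basis B s) t)^t* *m (cb_basis (col_basis B s))^t*.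

Definition uniform_compression (R : realType) (Cqr Csvd1 Csvd2 : R)
    (K : kernels Cqr Csvd1 Csvd2) (rule : rank_rule R)
    (I J : finType) (TI : cluster_tree I) (TJ : cluster_tree J)
    (T : block_cluster_tree TI TJ) (A : I -> J -> R[i]) (H : hmatrix T A)
    (epsI : {set I} -> R) (epsJ : {set J} -> R) :
    counted (uniform_hmatrix R (block_rank H)) :=
  do U <- for_each (adm_rows H) (fun t =>
            compress_cluster K rule (epsI t) (rowset H t)
              (fun s => factX H t s) (fun s => factY H t s));
  do V <- for_each (adm_cols H) (fun s =>
            compress_cluster K rule (epsJ s) (colset H s)
              (fun t => factY H t s) (fun t => factX H t s));
  cret (UniformHMatrix U V).

(* Main.v *)
(* The clusters of one level are pairwise disjoint, so the sizes of all clusters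
   add up to at most L(T_I) |I|; and since every inner cluster has at least two
   children, there are at most 2 |I| clusters. For a cluster t with stacked rank
   k_tot <= c_sp k_max, the triangular products and the SVD cost
   O(|t| k_tot^2 + k_tot^3), as do the scaling and the solves. The QR
   decompositions of the factors Y_b for b = t x s cost O(|s| k_b^2) each, and
   every s occurs in at most c_sp blocks b, so summing over t first gives
   O(c_sp k_max^2 L(T_J) |J|). *)
Require Import Defs.
From HB Require Import structures.
From mathcomp Require Import all_boot all_order all_algebra.
From mathcomp Require Import complex reals.
From mathcomp Require Import lra.

Set Implicit Arguments.
Unset Strict Implicit.
Unset Printing Implicit Defensive.

Import Order.TTheory GRing.Theory Num.Theory.

(** * Cluster trees: paths, levels and the total size of the clusters *)

Lemma leq_card_bigcup (I T : finType) (P : {pred I}) (F : I -> {set T}) :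
  #|\bigcup_(i in P) F i| <= \sum_(i in P) #|F i|.
Proof.
elim/big_ind2: _ => [|m A n B leAm leBn|//]; first by rewrite cards0.
by rewrite (leq_trans (leq_card_setU A B)) ?leq_add.
Qed.

Lemma children_clusters (I : finType) (T : cluster_tree I) (t u : {set I}) :
  t \in clusters T -> u \in children T t -> u \in clusters T.
Proof. by move=> tT; apply/subsetP/children_sub. Qed.

Lemma children_partition_mem (I : finType) (T : cluster_tree I) (t u : {set I}) :
  t \in clusters T -> u \in children T t -> partition (children T t) t.
Proof.
by move=> tT ut; apply: children_partition => //; apply/set0Pn; exists u.
Qed.

(* A loop would give the vertices on it several paths from the root. *)
Lemma cluster_upath (I : finType) (T : cluster_tree I) (t : {set I}) :
  t \in clusters T -> exists p : seq {set I},
    [/\ path (fun u v => v \in children T u) [set: I] p,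
        last [set: I] p = t & uniq ([set: I] :: p)].
Proof.
move=> tT; have [p [[Tp pt] _]] := cluster_path tT; move: pt.
by case/shortenP: Tp => q Tq uq _ qt; exists q.
Qed.

Lemma path_clusters (I : finType) (T : cluster_tree I) (t : {set I}) p :
    t \in clusters T -> path (fun u v => v \in children T u) t p ->
  {subset t :: p <= clusters T}.
Proof.
elim: p t => [|v p IHp] t tT /=; first by move=> _ u; rewrite inE => /eqP->.
move=> /andP[vt Tp] u; rewrite inE => /predU1P[->//|].
exact: IHp (children_clusters tT vt) Tp u.
Qed.

Lemma path_generation (I : finType) (T : cluster_tree I) (t u : {set I}) n p :
    t \in generation T n -> path (fun u v => v \in children T u) t p ->
  last t p \in generation T (n + size p).
Proof.
elim: p t n => [|v p IHp] t n tn /=; first by rewrite addn0.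
move=> /andP[vt Tp]; rewrite addnS -addSn; apply: IHp Tp.
by apply/bigcupP; exists t.
Qed.

(** The search in [level] only runs below the number of clusters, so it has to succeed there. A path
    from the root without repetitions does this: its vertices, one more than its length, are
    distinct clusters. *)
Lemma generation_level (I : finType) (T : cluster_tree I) (t : {set I}) :
  t \in clusters T -> t \in generation T (level T t).
Proof.
move=> tT; have [p [Tp pt up]] := cluster_upath tT.
have tp : t \in generation T (size p).
  by rewrite -pt -(add0n (size p)); apply: path_generation => //; rewrite set11.
have ltp : size p < #|clusters T|.
  rewrite -[(size p).+1]/(size ([set: I] :: p)) -(card_uniqP up).
  by apply/subset_leq_card/subsetP/path_clusters/Tp/root_cluster.
have /(nth_find 0) : has (fun n => t \in generation T n) (iota 0 #|clusters T|).
  by apply/hasP; exists (size p) => //; rewrite mem_iota.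
rewrite nth_iota // -[ltnRHS](size_iota 0) -has_find.
by apply/hasP; exists (size p) => //; rewrite mem_iota.
Qed.

(** Induction on n: two clusters with the same parent are disjoint as parts of a partition, and
    clusters with different parents lie in sets that are disjoint by induction. The inclusion is
    carried along because the partition property holds at clusters only. *)
Lemma generation_disjoint (I : finType) (T : cluster_tree I) n :
  generation T n \subset clusters T /\ trivIset (generation T n).
Proof.
elim: n => [|n [/subsetP gT tI]].
  by rewrite sub1set root_cluster trivIset1.
split; first by apply/bigcupsP => t /gT /children_sub.
apply/trivIsetP => u v /bigcupP[t tn ut] /bigcupP[s sn vs] neq_uv.
have pt := children_partition_mem (gT t tn) ut.
have ps := children_partition_mem (gT s sn) vs.
have [eq_ts|neq_ts] := eqVneq t s.
  by apply: (trivIsetP (partition_trivIset pt)) => //; rewrite eq_ts.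
apply: disjointW (trivIsetP tI t s tn sn neq_ts).
  exact: partitionS pt ut.
exact: partitionS ps vs.
Qed.

(** Counted by elements: two different clusters that contain x cannot be on the same level, so
    [level] maps the clusters around x injectively into ['I_(depth T)]. *)
Lemma sum_card_clusters (I : finType) (T : cluster_tree I) :
  \sum_(t in clusters T) #|t| <= depth T * #|I|.
Proof.
rewrite (eq_bigr (fun t : {set I} => \sum_(x | x \in t) 1)); last first.
  by move=> t _; rewrite sum1_card.
rewrite (exchange_big_dep predT) //= mulnC -sum_nat_const; apply: leq_sum => x _.
rewrite sum1dep_card -[depth T]card_ord.
pose f t := inord (level T t) : 'I_(depth T).
have lvl_le t : t \in clusters T -> level T t < depth T.
  by move=> tT; exact: (leq_bigmax_cond (F := level T) t tT).
rewrite -(@card_in_imset _ _ f) ?max_card // => t u.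
rewrite !inE => /andP[tT xt] /andP[uT xu] /(congr1 val).
rewrite /= !inordK ?lvl_le // => eq_lvl.
have [_ /trivIsetP gI] := generation_disjoint T (level T t).
apply/eqP/negP => /negP neq_tu.
have /pred0P/(_ x) : [disjoint t & u].
  by apply: gI => //; [|rewrite eq_lvl]; apply: generation_level.
by rewrite /= xt xu.
Qed.

(** * The number of clusters *)

(** Otherwise appending t to the path from the root to t would give a second such path. *)
Lemma children_neq (I : finType) (T : cluster_tree I) (t : {set I}) :
  t \in clusters T -> t \notin children T t.
Proof.
move=> tT; apply/negP => tt; have [p [[Tp pt] uniq_p]] := cluster_path tT.
have /(congr1 size) : p = rcons p t.
  by apply: uniq_p; rewrite last_rcons rcons_path Tp pt.
by rewrite size_rcons => /n_Sn.
Qed.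

Lemma children_proper (I : finType) (T : cluster_tree I) (t u : {set I}) :
  t \in clusters T -> u \in children T t -> u \proper t.
Proof.
move=> tT ut; rewrite properEneq (partitionS (children_partition_mem tT ut) ut).
by rewrite andbT; apply: contraTneq ut => ->; apply: children_neq.
Qed.

(** An only child would cover t and hence equal t. *)
Lemma card_children_gt1 (I : finType) (T : cluster_tree I) (t : {set I}) :
  t \in clusters T -> children T t != set0 -> 1 < #|children T t|.
Proof.
move=> tT cn0; have pt := children_partition tT cn0.
rewrite ltn_neqAle card_gt0 cn0 andbT eq_sym; apply/negP => /cards1P[u cu].
have ut : u \in children T t by rewrite cu set11.
have := children_proper tT ut; rewrite -(cover_partition pt) cu cover1.
by rewrite properxx.
Qed.

(** Reflexive: t is among its own descendants. *)
Definition descendants (I : finType) (T : cluster_tree I) (t : {set I}) :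
    {set {set I}} :=
  [set u | connect (fun u v => v \in children T u) t u].

(** The successor strengthens the bound so that the induction on the size of t closes: summed over
    the children it contributes their number, at least 2, which pays for t itself and for the
    successor on the left. At a leaf the bound is 2 <= 2 |t|, where t is nonempty. *)
Lemma card_descendants (I : finType) (T : cluster_tree I) (t : {set I}) :
  t \in clusters T -> (#|descendants T t|).+1 <= 2 * #|t|.
Proof.
have [n] := ubnP #|t|; elim: n t => // n IHn t ltn tT.
have desc_sub : descendants T t \subset
    t |: \bigcup_(u in children T t) descendants T u.
  apply/subsetP => v; rewrite !inE => /connectP[[|u p]] /=.
    by move=> _ ->; rewrite eqxx.
  move=> /andP[ut Tp] ->; apply/orP; right; apply/bigcupP; exists u => //.
  by rewrite inE; apply/connectP; exists p.
have t_gt0 : 0 < #|t|.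
  by rewrite card_gt0; apply: contraNneq (clusters_neq0 T) => <-.
have := leq_trans (subset_leq_card desc_sub) (leq_card_setU _ _).
rewrite cards1 add1n -ltnS => le_desc; apply: leq_trans le_desc _.
have [c0|cn0] := eqVneq (children T t) set0.
  by rewrite c0 big_set0 cards0 leq_pmulr.
rewrite -add2n.
have : \sum_(u in children T t) (#|descendants T u|).+1 <= 2 * #|t|.
  rewrite (card_partition (children_partition tT cn0)) big_distrr /=.
  apply: leq_sum => u ut; apply: IHn; last exact: children_clusters ut.
  exact: leq_trans (proper_card (children_proper tT ut)) ltn.
under eq_bigr do rewrite -add1n; rewrite big_split /= sum1_card.
by apply: leq_trans; rewrite leq_add ?card_children_gt1 ?leq_card_bigcup.
Qed.

Lemma card_clusters (I : finType) (T : cluster_tree I) :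
  #|clusters T| <= 2 * #|I|.
Proof.
have /ltnW := card_descendants (root_cluster T); rewrite cardsT; apply: leq_trans.
apply/subset_leq_card/subsetP => t tT; rewrite inE; apply/connectP.
by have [p [Tp pt _]] := cluster_upath tT; exists p.
Qed.

(** * Operations for a single cluster *)

Local Open Scope ring_scope.
Local Open Scope complex_scope.

Lemma leq_sum_const (S : finType) (D : {set S}) (F : S -> nat) (c n : nat) :
  (#|D| <= c -> (forall s, s \in D -> F s <= n) -> \sum_(s in D) F s <= c * n)%N.
Proof.
move=> leDc leFn; apply: leq_trans (_ : #|D| * n <= _)%N; last exact: leq_mul.
by rewrite -sum_nat_const leq_sum.
Qed.

Lemma leq_mulX2 (c n : nat) : (c * n ^ 2 <= (c * n) ^ 2)%N.
Proof.
rewrite expnMn leq_mul2r; apply/orP; right.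
by case: c => // c; rewrite expnS leq_pmulr.
Qed.

(** The stacked rank is at most [c * n]. The 1 added to [Csvd1] pays for the triangular products,
    the 2 added to [Csvd2] for the scaling and the solves. The QR term keeps the sizes [h s], which
    belong to the other index set and are summed only over a whole pass. *)
Lemma compress_cluster_ops (R : realType) (Cqr Csvd1 Csvd2 : R)
    (K : kernels Cqr Csvd1 Csvd2) (rule : rank_rule R) (eps : R)
    (S : finType) (D : {set S}) (m : nat) (h k : S -> nat)
    (X : forall s, 'M[R[i]]_(m, k s)) (Y : forall s, 'M[R[i]]_(h s, k s))
    (c n : nat) :
    0 <= Cqr -> 0 <= Csvd1 -> 0 <= Csvd2 ->
    (#|D| <= c)%N -> (forall s, s \in D -> (k s <= n)%N) ->
  (ops (compress_cluster K rule eps D X Y))%:R <=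
    Cqr * n%:R ^+ 2 * (\sum_(s in D) h s)%:R
    + (Csvd1 + 1) * (c * n)%:R ^+ 2 * m%:R + (Csvd2 + 2) * (c * n)%:R ^+ 3 :> R.
Proof.
move=> Cqr_ge0 Csvd1_ge0 Csvd2_ge0 leDc lekn.
pose N := (\sum_(j < #|D|) k (enum_val j))%N.
have leN : (N <= c * n)%N by rewrite /N -(big_enum_val k) leq_sum_const.
have le_sum_sqr : (\sum_(s in D) k s ^ 2 <= (c * n) ^ 2)%N.
  apply: leq_trans (leq_mulX2 c n).
  by apply: leq_sum_const => // s sD; rewrite leq_sqr lekn.
have qr_le : (\sum_(s in D) ops (qr K (Y s)))%:R <=
    Cqr * n%:R ^+ 2 * (\sum_(s in D) h s)%:R :> R.
  rewrite !natr_sum mulr_sumr; apply: ler_sum => s sD.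
  apply: le_trans (qr_ops K (Y s)) _; rewrite mulrAC ler_wpM2r // ler_wpM2l //.
  by rewrite -!natrX ler_nat leq_sqr lekn.
have mul_le : (\sum_(s in D) m * k s ^ 2 <= (c * n) ^ 2 * m)%N.
  by rewrite -big_distrr /= mulnC leq_mul2r le_sum_sqr orbT.
rewrite /compress_cluster /=.
set M := \mxrow_(j < #|D|) _; have := svd_ops K M.
case: (svd K M) => [[[U d] V] o] /= svd_le.
(* A rank rule returns a number up to the number of columns, here [N]. *)
set l := rule eps _ d; have lel : (l <= c * n)%N.
  by rewrite (leq_trans _ leN) // -ltnS ltn_ord.
have scale_le : (\sum_(s in D) l * k s <= (c * n) ^ 3)%N.
  rewrite -big_distrr /= (leq_trans (leq_mul lel (leq_sum_const leDc lekn))) //.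
  (* A square is at most the cube; the base 0 is treated apart. *)
  by rewrite mulnn; case: (c * n)%N => // x; rewrite leq_pexp2l.
have solve_le : (\sum_(s in D) l * k s ^ 2 <= (c * n) ^ 3)%N.
  by rewrite -big_distrr /= expnS leq_mul.
have {}svd_le : o%:R <= Csvd1 * (c * n)%:R ^+ 2 * m%:R + Csvd2 * (c * n)%:R ^+ 3 :> R.
  apply: le_trans svd_le _; rewrite mulrAC -!natrX.
  by rewrite lerD ?ler_wpM2r ?ler_wpM2l ?ler_nat ?leq_exp2r.
move: mul_le scale_le solve_le.
(* Only the product with [m] is split: [(c * n)%:R] stays an atom for [lra]. *)
rewrite -!(ler_nat R) !(natrD, natrX) (natrM _ _ m) natrX => *.
lra.
Qed.

(** * Operations for one pass over all clusters *)

Lemma double_count (S T : finType) (E : {set T}) (F : {set S}) (D : T -> {set S})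
    (h : S -> nat) (c : nat) :
    (forall t, t \in E -> D t \subset F) ->
    (forall s, s \in F -> #|[set t in E | s \in D t]| <= c)%N ->
  (\sum_(t in E) \sum_(s in D t) h s <= c * \sum_(s in F) h s)%N.
Proof.
move=> DF leEc; rewrite (exchange_big_dep (mem F)) /=; last first.
  by move=> t s tE; apply/subsetP/DF.
rewrite big_distrr; apply: leq_sum => s sF /=.
by rewrite sum_nat_const leq_mul2r -cardsE leEc ?orbT.
Qed.

(** Stated for abstract families so that the row pass and the column pass are both instances. [E]
    holds the clusters processed and [F] their possible partners; [c] bounds the blocks per cluster
    in both directions. *)
Lemma compress_pass_ops (R : realType) (Cqr Csvd1 Csvd2 : R)
    (K : kernels Cqr Csvd1 Csvd2) (rule : rank_rule R)
    (S T : finType) (E : {set T}) (F : {set S}) (D : T -> {set S}) (eps : T -> R)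
    (g : T -> nat) (h : S -> nat) (k : T -> S -> nat)
    (X : forall t s, 'M[R[i]]_(g t, k t s)) (Y : forall t s, 'M[R[i]]_(h s, k t s))
    (c n : nat) :
    0 <= Cqr -> 0 <= Csvd1 -> 0 <= Csvd2 ->
    (forall t, t \in E -> D t \subset F) ->
    (forall t, t \in E -> (#|D t| <= c)%N) ->
    (forall s, s \in F -> (#|[set t in E | s \in D t]| <= c)%N) ->
    (forall t s, t \in E -> s \in D t -> (k t s <= n)%N) ->
  (ops (for_each E (fun t =>
      compress_cluster K rule (eps t) (D t) (X t) (Y t))))%:R <=
    (c * n)%:R ^+ 2 * (Cqr * (\sum_(s in F) h s)%:R
                       + (Csvd1 + 1) * (\sum_(t in E) g t)%:R)
    + (Csvd2 + 2) * (c * n)%:R ^+ 3 * #|E|%:R :> R.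
Proof.
move=> Cqr_ge0 Csvd1_ge0 Csvd2_ge0 DF leDc leEc lekn.
rewrite /= natr_sum.
apply: (@le_trans _ _ (\sum_(t in E)
   (Cqr * n%:R ^+ 2 * (\sum_(s in D t) h s)%:R
    + (Csvd1 + 1) * (c * n)%:R ^+ 2 * (g t)%:R + (Csvd2 + 2) * (c * n)%:R ^+ 3))).
  apply: ler_sum => t tE.
  by apply: (compress_cluster_ops _ _ _ _ _ _ _ _ (leDc t tE)) => // s; apply: lekn.
rewrite !big_split /= sumr_const -!mulr_sumr -!natr_sum -[(_ * _ ^+ 3) *+ _]mulr_natr.
rewrite lerD2r -mulrA.
(* The factor c from the double counting is absorbed by c n^2 <= (c n)^2. *)
have count_le : n%:R ^+ 2 * (\sum_(t in E) \sum_(s in D t) h s)%:R <=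
    (c * n)%:R ^+ 2 * (\sum_(s in F) h s)%:R :> R.
  rewrite -!natrX -!natrM ler_nat.
  apply: leq_trans (leq_mul (leqnn _) (double_count h DF leEc)) _.
  by rewrite mulnA leq_mul2r mulnC leq_mulX2 orbT.
by have := ler_wpM2l Cqr_ge0 count_le; lra.
Qed.

(** * Rank and sparsity bounds, and the count for the whole algorithm *)

Lemma block_rank_le_k_max (R : realType) (I J : finType)
    (TI : cluster_tree I) (TJ : cluster_tree J) (T : block_cluster_tree TI TJ)
    (A : I -> J -> R[i]) (H : hmatrix T A) (t : {set I}) (s : {set J}) :
  t \in clusters TI -> s \in rowset H t -> (block_rank H t s <= k_max H)%N.
Proof.
move=> tT st; have tH : t \in adm_rows H.
  by rewrite inE tT; apply/set0Pn; exists s.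
apply: leq_trans (leq_bigmax_cond
  (F := fun t => \max_(s in rowset H t) block_rank H t s)%N t tH).
exact: (leq_bigmax_cond (F := block_rank H t) s st).
Qed.

(** The maximum in [c_sp] ranges over nonempty rows; an empty row satisfies the bound trivially. *)
Lemma card_rowset_le (R : realType) (I J : finType)
    (TI : cluster_tree I) (TJ : cluster_tree J) (T : block_cluster_tree TI TJ)
    (A : I -> J -> R[i]) (H : hmatrix T A) (t : {set I}) :
  t \in clusters TI -> (#|rowset H t| <= c_sp H)%N.
Proof.
move=> tT; have [->|r0] := eqVneq (rowset H t) set0; first by rewrite cards0.
have tH : t \in adm_rows H by rewrite inE tT.
rewrite leq_max; apply/orP; left.
exact: (leq_bigmax_cond (F := fun t => #|rowset H t|) t tH).
Qed.

Lemma card_colset_le (R : realType) (I J : finType)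
    (TI : cluster_tree I) (TJ : cluster_tree J) (T : block_cluster_tree TI TJ)
    (A : I -> J -> R[i]) (H : hmatrix T A) (s : {set J}) :
  s \in clusters TJ -> (#|colset H s| <= c_sp H)%N.
Proof.
move=> sT; have [->|c0] := eqVneq (colset H s) set0; first by rewrite cards0.
have sH : s \in adm_cols H by rewrite inE sT.
rewrite leq_max; apply/orP; right.
exact: (leq_bigmax_cond (F := fun s => #|colset H s|) s sH).
Qed.

(** The row pass charges [Cqr] to J and [Csvd1 + 1] to I, the column pass the reverse, so each index
    set receives the sum of both. The factor 2 in the cubic term comes from the bound 2 |I| on the
    number of clusters. *)
Lemma uniform_compression_ops (R : realType) (Cqr Csvd1 Csvd2 : R)
    (K : kernels Cqr Csvd1 Csvd2) (rule : rank_rule R)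
    (I J : finType) (TI : cluster_tree I) (TJ : cluster_tree J)
    (T : block_cluster_tree TI TJ) (A : I -> J -> R[i]) (H : hmatrix T A)
    (epsI : {set I} -> R) (epsJ : {set J} -> R) :
    0 <= Cqr -> 0 <= Csvd1 -> 0 <= Csvd2 ->
  (ops (uniform_compression K rule H epsI epsJ))%:R <=
    (Cqr + Csvd1 + 1) * (c_sp H * k_max H)%:R ^+ 2
      * ((depth TI * #|I|)%:R + (depth TJ * #|J|)%:R)
    + 2 * (Csvd2 + 2) * (c_sp H * k_max H)%:R ^+ 3 * (#|I|%:R + #|J|%:R) :> R.
Proof.
move=> Cqr_ge0 Csvd1_ge0 Csvd2_ge0.
have subI : adm_rows H \subset clusters TI by apply/subsetP=> t; rewrite inE => /andP[].
have subJ : adm_cols H \subset clusters TJ by apply/subsetP=> s; rewrite inE => /andP[].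
have rows_sub t : t \in adm_rows H -> rowset H t \subset clusters TJ.
  by move=> _; apply/subsetP => s; rewrite inE => /andP[].
have cols_sub s : s \in adm_cols H -> colset H s \subset clusters TI.
  by move=> _; apply/subsetP => t; rewrite inE => /andP[].
have le_rowset t : t \in adm_rows H -> (#|rowset H t| <= c_sp H)%N.
  by move=> /(subsetP subI); apply: card_rowset_le.
have le_colset s : s \in adm_cols H -> (#|colset H s| <= c_sp H)%N.
  by move=> /(subsetP subJ); apply: card_colset_le.
(* The rows that meet s form a part of its column, so the column half of [c_sp] bounds how often s
   occurs in the row pass. *)
have le_rows s : s \in clusters TJ ->
    (#|[set t in adm_rows H | s \in rowset H t]| <= c_sp H)%N.
  move=> sT; apply: leq_trans (card_colset_le H sT).
  apply/subset_leq_card/subsetP => t.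
  by rewrite !inE => /andP[/andP[-> _] /andP[_ ->]].
have le_cols t : t \in clusters TI ->
    (#|[set s in adm_cols H | t \in colset H s]| <= c_sp H)%N.
  move=> tT; apply: leq_trans (card_rowset_le H tT).
  apply/subset_leq_card/subsetP => s.
  by rewrite !inE => /andP[/andP[-> _] /andP[_ ->]].
have row_rank t s : t \in adm_rows H -> s \in rowset H t ->
    (block_rank H t s <= k_max H)%N.
  by move=> /(subsetP subI); apply: block_rank_le_k_max.
(* [k_max] is a maximum over rows, so a block met in a column is first read as a member of
   [rowset H t]. *)
have col_rank s t : s \in adm_cols H -> t \in colset H s ->
    (block_rank H t s <= k_max H)%N.
  move=> /(subsetP subJ) sT; rewrite inE => /andP[tT adm_ts].
  by apply: block_rank_le_k_max => //; rewrite inE sT.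
have row_ops := compress_pass_ops K rule epsI (factX H) (factY H)
  Cqr_ge0 Csvd1_ge0 Csvd2_ge0 rows_sub le_rowset le_rows row_rank.
have col_ops := compress_pass_ops K rule epsJ
  (fun s t => factY H t s) (fun s t => factX H t s)
  Cqr_ge0 Csvd1_ge0 Csvd2_ge0 cols_sub le_colset le_cols col_rank.
have le_sum (I' : finType) (T' : cluster_tree I') :
    (\sum_(t in clusters T') #|t|)%:R <= (depth T' * #|I'|)%:R :> R.
  by rewrite ler_nat sum_card_clusters.
have le_sum_adm (I' : finType) (T' : cluster_tree I') (E : {set {set I'}}) :
    E \subset clusters T' -> (\sum_(t in E) #|t|)%:R <= (depth T' * #|I'|)%:R :> R.
  move=> ET; rewrite ler_nat (leq_trans _ (sum_card_clusters T')) //.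
  by rewrite [leqRHS](big_setID E) /= (setIidPr ET) leq_addr.
have le_card (I' : finType) (T' : cluster_tree I') (E : {set {set I'}}) :
    E \subset clusters T' -> #|E|%:R <= 2 * #|I'|%:R :> R.
  move=> /subset_leq_card leE; rewrite -natrM ler_nat.
  exact: leq_trans leE (card_clusters T').
rewrite /= addn0 natrD; apply: le_trans (lerD row_ops col_ops) _.
set N := (c_sp H * k_max H)%:R; set nI := (depth TI * #|I|)%:R.
set nJ := (depth TJ * #|J|)%:R.
have N_ge0 : 0 <= N := ler0n R _.
have pass_le (x x' y y' z z' : R) : x <= x' -> y <= y' -> z <= z' ->
    N ^+ 2 * (Cqr * x + (Csvd1 + 1) * y) + (Csvd2 + 2) * N ^+ 3 * z <=
    N ^+ 2 * (Cqr * x' + (Csvd1 + 1) * y') + (Csvd2 + 2) * N ^+ 3 * z'.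
  move=> lex ley lez; apply: lerD; apply: ler_wpM2l => //.
  - by rewrite exprn_ge0.
  - by rewrite lerD // ler_wpM2l // addr_ge0.
  - by rewrite mulr_ge0 ?exprn_ge0 ?addr_ge0.
have := lerD
  (pass_le _ _ _ _ _ _ (le_sum J TJ) (le_sum_adm I TI _ subI) (le_card I TI _ subI))
  (pass_le _ _ _ _ _ _ (le_sum I TI) (le_sum_adm J TJ _ subJ) (le_card J TJ _ subJ)).
by move=> le_ops; apply: le_trans le_ops _; rewrite -/nI -/nJ; lra.
Qed.

(* Asymptotic complexity *)
From mathcomp Require Import all_classical all_reals all_analysis.
Import numFieldNormedType.Exports.

Local Open Scope classical_set_scope.
Local Open Scope ring_scope.
Local Open Scope complex_scope.

(** At n = 0 the logarithm has the default value 0. *)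
Lemma ln_nat_ge0 (R : realType) (n : nat) : 0 <= ln n%:R :> R.
Proof. by case: n => [|n]; [rewrite ln0 | rewrite ln_ge0 // ler1n]. Qed.

Theorem lemma4p2 (R : realType) (Cqr Csvd1 Csvd2 : R)
    (Cqr_gt0 : 0 < Cqr) (Csvd1_gt0 : 0 < Csvd1) (Csvd2_gt0 : 0 < Csvd2) :
  (exists Cqlin Clin : R, [/\ 0 < Cqlin, 0 < Clin &
     forall (K : kernels Cqr Csvd1 Csvd2) (rule : rank_rule R)
       (I J : finType) (TI : cluster_tree I) (TJ : cluster_tree J)
       (T : block_cluster_tree TI TJ) (A : I -> J -> R[i]) (H : hmatrix T A)
       (epsI : {set I} -> R) (epsJ : {set J} -> R),
     (ops (uniform_compression K rule H epsI epsJ))%:R <=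
       Cqlin * (c_sp H * k_max H)%:R ^+ 2
         * ((depth TI * #|I|)%:R + (depth TJ * #|J|)%:R)
       + Clin * (c_sp H * k_max H)%:R ^+ 3 * (#|I|%:R + #|J|%:R)])
  /\
  (forall (K : kernels Cqr Csvd1 Csvd2) (rule : rank_rule R)
     (I J : nat -> finType)
     (TI : forall n, cluster_tree (I n)) (TJ : forall n, cluster_tree (J n))
     (T : forall n, block_cluster_tree (TI n) (TJ n))
     (A : forall n, I n -> J n -> R[i]) (H : forall n, hmatrix (T n) (A n))
     (epsI : forall n, {set I n} -> R) (epsJ : forall n, {set J n} -> R),
     (fun n => #|I n| + #|J n|)%N @ \oo --> \oo ->
     (fun n => (depth (TI n))%:R : R^o) =Theta_\oo (fun n => ln #|I n|%:R : R^o) ->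
     (fun n => (depth (TJ n))%:R : R^o) =Theta_\oo (fun n => ln #|J n|%:R : R^o) ->
     (exists c : nat, forall n, (c_sp (H n) <= c)%N) ->
     (exists k : nat, forall n, (k_max (H n) <= k)%N) ->
     (fun n => (ops (uniform_compression K rule (H n) (@epsI n) (@epsJ n)))%:R : R^o)
       =O_\oo (fun n => #|I n|%:R * ln #|I n|%:R + #|J n|%:R * ln #|J n|%:R : R^o)).
Proof.
split.
  exists (Cqr + Csvd1 + 1), (2 * (Csvd2 + 2)); split; [lra|lra|].
  by move=> *; apply: uniform_compression_ops; apply: ltW.
move=> K rule I J TI TJ T A H epsI epsJ _.
(* Constants [a] and [b] such that eventually the depths are at most [a] and [b] times the
   logarithms. *)
rewrite eqThetaE bigThetaE => -[/eqO_exP[a a_gt0 depthI_le] _].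
rewrite eqThetaE bigThetaE => -[/eqO_exP[b b_gt0 depthJ_le] _] [c lec] [k lek].
pose P : R := (Cqr + Csvd1 + 1) * (c * k)%:R ^+ 2 + 2 * (Csvd2 + 2) * (c * k)%:R ^+ 3.
have P_ge0 : 0 <= P by rewrite addr_ge0 ?mulr_ge0 ?exprn_ge0 //; lra.
(* The added 1 keeps the constant positive when [P] is 0, as for c k = 0. *)
apply/eqO_exP; exists (P * (a + b) + 1); first by rewrite ltr_wpDl // mulr_ge0 //; lra.
apply: filterS2 depthI_le depthJ_le => n.
have lnI := ln_nat_ge0 R #|I n|; have lnJ := ln_nat_ge0 R #|J n|.
rewrite /= !ger0_norm ?addr_ge0 ?mulr_ge0 // => depthI_le depthJ_le.
have := uniform_compression_ops K rule (H n) (@epsI n) (@epsJ n)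
  (ltW Cqr_gt0) (ltW Csvd1_gt0) (ltW Csvd2_gt0).
set N := (c_sp (H n) * k_max (H n))%N => ops_le.
have leN : (N <= c * k)%N by rewrite leq_mul.
set i := #|I n| in lnI depthI_le ops_le *; set j := #|J n| in lnJ depthJ_le ops_le *.
set x := ln i%:R in lnI depthI_le *; set y := ln j%:R in lnJ depthJ_le *.
(* Since a depth is at least 1, the linear sizes are absorbed by the terms depth times size. *)
have depth_ge1 (L m : nat) : (0 < L)%N -> m%:R <= (L * m)%:R :> R.
  by move=> L_gt0; rewrite ler_nat leq_pmull.
apply: le_trans ops_le _.
apply: (@le_trans _ _ (P * ((depth (TI n) * i)%:R + (depth (TJ n) * j)%:R))).
  rewrite /P [leRHS]mulrDl; apply: lerD.
    apply: ler_wpM2r; first by rewrite addr_ge0.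
    by apply: ler_wpM2l; [lra | rewrite -!natrX ler_nat leq_exp2r].
  apply: ler_pM; rewrite ?mulr_ge0 ?exprn_ge0 ?addr_ge0 //; [lra| |].
    by apply: ler_wpM2l; [lra | rewrite -!natrX ler_nat leq_exp2r].
  by rewrite lerD ?depth_ge1.
(* Taking [a + b] as common factor adds the cross terms b i x and a j y, which are nonnegative. *)
have ab_le : (depth (TI n) * i)%:R + (depth (TJ n) * j)%:R <=
    (a + b) * (i%:R * x + j%:R * y).
  have ix : 0 <= i%:R * x by rewrite mulr_ge0.
  have jy : 0 <= j%:R * y by rewrite mulr_ge0.
  have leI := ler_wpM2r (ler0n R i) depthI_le.
  have leJ := ler_wpM2r (ler0n R j) depthJ_le.
  have := mulr_ge0 (ltW b_gt0) ix; have := mulr_ge0 (ltW a_gt0) jy.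
  by rewrite !natrM; lra.
apply: le_trans (ler_wpM2l P_ge0 ab_le) _.
by rewrite mulrA [leRHS]mulrDl mul1r lerDl addr_ge0 ?mulr_ge0.
Qed.
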